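(* Let $S\subseteq\{0,1\}^n$ be a cube-ideal set-system with connectivity at least $2$, and fix an inequality description of $\mathrm{conv}(S)$ consisting of capacity and GSC inequalities. Let $d$ be the number of connected components of the $2$-cover graph $G(S)$, and let $\kappa$ be the minimum number of variables used in a rainbow inequality belonging to the fixed description ($\kappa=+\infty$ if the fixed description contains no rainbow inequality, in which case $H(1/\kappa)$ is read as $H(0)=0$). Then $|\mathrm{core}(S)|\geq 2^{(1-H(1/\kappa))d}$.
   Context: A set-system is a subset $S\subseteq\{0,1\}^n$; $\mathrm{conv}(S)$ is its convex hull. A capacity inequality is $x_i\geq0$ or $x_i\leq1$. A GSC (generalized set covering) inequality is $\sum_{i\in I}x_i+\sum_{j\in J}(1-x_j)\geq1$ for disjoint $I,J\subseteq[n]$; it uses $|I|+|J|$ variables; a $2$-GSC inequality is one using exactly $2$ variables. $S$ is cube-ideal if $\mathrm{conv}(S)$ is the solution set of some finite family of capacity and GSC inequalities. The connectivity of $S$ is the minimum number of variables in a GSC inequality valid for $\mathrm{conv}(S)$ ($+\infty$ if $S=\{0,1\}^n$). For $S$ of connectivity at least 2, the $2$-cover graph $G(S)$ is the graph on vertex set $[n]$ with an edge $\{i,j\}$ for each pair of distinct indices such that at least one of $x_i+(1-x_j)\geq1$, $(1-x_i)+x_j\geq1$, $x_i+x_j\geq1$, $(1-x_i)+(1-x_j)\geq1$ is valid for $\mathrm{conv}(S)$. $\mathrm{core}(S)$ is the set of points of $S$ satisfying every $2$-GSC inequality valid for $\mathrm{conv}(S)$ with equality. A GSC inequality $\sum_{i\in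 I}x_i+\sum_{j\in J}(1-x_j)\geq1$ valid for $\mathrm{conv}(S)$ is rainbow if $I\cup J$ intersects every connected component of $G(S)$ in at most one element. $H$ is the binary entropy function $H(\varepsilon)=-\varepsilon\log_2\varepsilon-(1-\varepsilon)\log_2(1-\varepsilon)$ for $\varepsilon\in(0,\tfrac12]$, $H(0)=0$. *)

(* Defs.v *)
From mathcomp Require Import all_boot all_order all_algebra.
From mathcomp Require Import all_classical all_reals all_analysis.

Set Implicit Arguments.
Unset Strict Implicit.
Unset Printing Implicit Defensive.

Import Order.TTheory GRing.Theory Num.Theory.

Local Open Scope classical_set_scope.
Local Open Scope ring_scope.

Section CubeIdeal.
Variables (R : realType) (n : nat).

Definition cube_point := {ffun 'I_n -> bool}.

Definition vec (s : cube_point) : 'rV[R]_n := \row_i (s i)%:R.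

Definition conv_hull (S : {set cube_point}) : set 'rV[R]_n :=
  [set x | exists w : cube_point -> R,
    [/\ forall s, s \in S -> 0 <= w s,
        \sum_(s in S) w s = 1
      & x = \sum_(s in S) w s *: vec s]].

Definition gsc_lhs (I J : {set 'I_n}) (x : 'rV[R]_n) : R :=
  \sum_(i in I) x ord0 i + \sum_(j in J) (1 - x ord0 j).

Definition gsc_valid (S : {set cube_point}) (I J : {set 'I_n}) : Prop :=
  forall x, conv_hull S x -> 1 <= gsc_lhs I J x.

Record gsc := Gsc {
  gsc_pos : {set 'I_n};
  gsc_neg : {set 'I_n};
  gsc_disj : [disjoint gsc_pos & gsc_neg]%B }.

Definition nvars (g : gsc) : nat := (#|gsc_pos g| + #|gsc_neg g|)%N.

Inductive ineq :=
  | CapLower of 'I_n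
  | CapUpper of 'I_n
  | Cover of gsc.

Definition satisfies (x : 'rV[R]_n) (q : ineq) : Prop :=
  match q with
  | CapLower i => 0 <= x ord0 i
  | CapUpper i => x ord0 i <= 1
  | Cover g => 1 <= gsc_lhs (gsc_pos g) (gsc_neg g) x
  end.

Definition describes (D : set ineq) (S : {set cube_point}) : Prop :=
  finite_set D /\ conv_hull S = [set x | forall q, D q -> satisfies x q].

Definition cube_ideal (S : {set cube_point}) : Prop :=
  exists D : set ineq, describes D S.

(* The infimum is over a set of natural numbers, so it is a minimum, or +oo
   when no GSC inequality is valid.  I = J = set0 is allowed: it is valid
   exactly when S is empty, which then has connectivity 0. *)
Definition connectivity (S : {set cube_point}) : \bar R :=
  ereal_inf [set (nvars g)%:R%:E
            | g in [set g | gsc_valid S (gsc_pos g) (gsc_neg g)]].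

Definition two_cover_graph (S : {set cube_point}) : rel 'I_n :=
  fun i j => (i != j) &&
    `[< [\/ gsc_valid S [set i]%SET [set j]%SET,
            gsc_valid S [set j]%SET [set i]%SET,
            gsc_valid S [set i; j]%SET finset.set0
          | gsc_valid S finset.set0 [set i; j]%SET] >].

Definition ncomponents (S : {set cube_point}) : nat :=
  n_comp (two_cover_graph S) predT.

Definition core (S : {set cube_point}) : {set cube_point} :=
  [set s in S | `[< forall g : gsc, nvars g = 2%N ->
      gsc_valid S (gsc_pos g) (gsc_neg g) ->
      gsc_lhs (gsc_pos g) (gsc_neg g) (vec s) = 1 >]]%SET.

Definition rainbow (S : {set cube_point}) (g : gsc) : Prop :=
  gsc_valid S (gsc_pos g) (gsc_neg g) /\
  forall i : 'I_n,
    (#|[set j in gsc_pos g :|: gsc_neg g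
          | connect (two_cover_graph S) i j]%SET| <= 1)%N.

Definition kappa (S : {set cube_point}) (D : set ineq) : \bar R :=
  ereal_inf [set (nvars g)%:R%:E | g in [set g | D (Cover g) /\ rainbow S g]].

End CubeIdeal.

Arguments cube_ideal R {n} S.
Arguments connectivity R {n} S.
Arguments describes R {n} D S.
Arguments ncomponents R {n} S.
Arguments core R {n} S.
Arguments kappa R {n} S D.

Section Entropy.
Variable R : realType.

Definition log2 (x : R) : R := ln x / ln 2.

Definition entropy (e : R) : R :=
  if e == 0 then 0 else - e * log2 e - (1 - e) * log2 (1 - e).

Definition recip (k : \bar R) : R := if k is r%:E then r^-1 else 0.

End Entropy.

(* Main.v *)
Require Import Defs.
From mathcomp Require Import all_boot all_order all_algebra.
From mathcomp Require Import all_classical all_reals all_analysis.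
From mathcomp Require Import ring lra.
Import Order.TTheory GRing.Theory Num.Theory.
Local Open Scope ring_scope.

(* The centre (1/2, .., 1/2) lies in conv(S) and makes every valid 2-GSC
   inequality tight, so the core is nonempty; on each of the d components of
   G(S) its points coincide up to global complementation.  Write ep = 1/kappa.
   For each choice v of one bit per component, the point whose coordinates are
   ep or 1 - ep accordingly satisfies the rainbow inequalities of the
   description, and the non-rainbow ones turn out to be redundant, so this
   point is an average of core points.  Their average Hamming distance to v is
   ep * d, hence some core point is within ep * d of v.  That point has weight
   ep^dist (1 - ep)^(d - dist) >= 2^(- H(ep) d); summing over the 2^d choices
   of v, each core point contributes total weight 1. *)

(** Among the affine functions running from [a i] to [b i] that end negative, pick one with the
    least root [a i / (a i - b i)]; no other has gone negative by then. Along a segment leaving a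
    polyhedron this finds the first constraint met. *)
Lemma first_zero_affine {R : realFieldType} {I : finType} (P : pred I)
    (a b : I -> R) :
  (forall i, P i -> 0 <= a i) -> (exists2 i, P i & b i < 0) ->
  exists i t, [/\ P i, b i < 0, 0 <= t < 1, (1 - t) * a i + t * b i = 0
    & forall j, P j -> 0 <= (1 - t) * a j + t * b j].
Proof.
move=> a_ge0 [i0 Pi0 bi0].
pose Q i := P i && (b i < 0); pose th i := a i / (a i - b i).
have Qi0 : Q i0 by rewrite /Q Pi0.
case: (@arg_minP _ R I i0 Q th Qi0) => i /andP[Pi bi] min_i.
have ai := a_ge0 _ Pi; have abi : 0 < a i - b i by lra.
have thM : th i * (a i - b i) = a i by rewrite /th mulfVK// gt_eqF.
have th0 : 0 <= th i by rewrite divr_ge0// ltW.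
have th1 : th i < 1 by rewrite /th ltr_pdivrMr//; lra.
exists i, (th i); split => //; first by rewrite th0.
  by rewrite mulrBl mul1r -{1}thM; ring.
move=> j Pj; have aj := a_ge0 _ Pj.
have [bj|bj] := leP 0 (b j).
  by rewrite addr_ge0// mulr_ge0// subr_ge0 ltW.
have abj : 0 < a j - b j by lra.
have : th i <= th j by apply: min_i; rewrite /Q Pj.
by rewrite {2}/th ler_pdivlMr// => ?; lra.
Qed.

(** * Cover inequalities as sums of literals *)

Section Literals.
Context {R : realType} {n : nat}.
Implicit Types (g : gsc n) (x y : 'rV[R]_n) (s : cube_point n).

Definition gsc_supp g : {set 'I_n} := gsc_pos g :|: gsc_neg g.

(** Meaningful for [i] in [gsc_supp g]; elsewhere it takes the default value [1 - x ord0 i]. *)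
Definition lit g x i : R := if i \in gsc_pos g then x ord0 i else 1 - x ord0 i.

Lemma gsc_negE g i : (i \in gsc_neg g) = (i \in gsc_supp g) && (i \notin gsc_pos g).
Proof.
rewrite inE; have [ip|] := boolP (i \in gsc_pos g); last by rewrite andbT.
by rewrite (disjointFr (gsc_disj g) ip).
Qed.

Lemma card_gsc_supp g : #|gsc_supp g| = nvars g.
Proof. by rewrite cardsU disjoint_setI0 ?gsc_disj// cards0 subn0. Qed.

Lemma gsc_lhsE g x :
  gsc_lhs (gsc_pos g) (gsc_neg g) x = \sum_(i in gsc_supp g) lit g x i.
Proof.
rewrite (eq_bigl _ _ (fun i => finset.in_setU i _ _)) (bigU _ _ _ (gsc_disj g))/=.
congr (_ + _); apply: eq_bigr => i; rewrite /lit; first by move=> ->.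
by rewrite gsc_negE => /andP[_ /negPf ->].
Qed.

Lemma lit_ge0 g x i : 0 <= x ord0 i <= 1 -> 0 <= lit g x i.
Proof. by rewrite /lit; case: ifP; lra. Qed.

Lemma lit_vec g s i : lit g (vec R s) i = (s i == (i \in gsc_pos g))%:R.
Proof. by rewrite /lit mxE; case: (_ \in _) (s i) => -[]; rewrite ?subr0 ?subrr. Qed.

Lemma lit_half g i : lit g (const_mx 2^-1) i = 2^-1 :> R.
Proof. by rewrite /lit !mxE; case: ifP => // _; field. Qed.

Lemma gsc_lhs_half g :
  gsc_lhs (gsc_pos g) (gsc_neg g) (const_mx 2^-1) = 2^-1 * (nvars g)%:R :> R.
Proof.
rewrite gsc_lhsE (eq_bigr _ (fun i _ => lit_half g i)).
by rewrite sumr_const card_gsc_supp mulr_natr.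
Qed.

Lemma lit_segment g x y t i :
  lit g ((1 - t) *: x + t *: y) i = (1 - t) * lit g x i + t * lit g y i.
Proof. by rewrite /lit !mxE; case: ifP => _; ring. Qed.

Lemma gsc_lhs_segment g x y t :
  gsc_lhs (gsc_pos g) (gsc_neg g) ((1 - t) *: x + t *: y) =
  (1 - t) * gsc_lhs (gsc_pos g) (gsc_neg g) x
  + t * gsc_lhs (gsc_pos g) (gsc_neg g) y.
Proof.
by rewrite !gsc_lhsE !mulr_sumr -big_split; apply: eq_bigr => i _; rewrite lit_segment.
Qed.

Lemma lit_conv g (S : {set cube_point n}) (w : cube_point n -> R) i :
  \sum_(s in S) w s = 1 ->
  lit g (\sum_(s in S) w s *: vec R s) i = \sum_(s in S) w s * lit g (vec R s) i.
Proof.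
move=> w1; rewrite /lit summxE; under eq_bigr do rewrite mxE.
case: ifP => _ //; rewrite -[X in X - _]w1 -sumrB.
by apply: eq_bigr => s _; ring.
Qed.

Lemma gsc_lhs_conv g (S : {set cube_point n}) (w : cube_point n -> R) :
  \sum_(s in S) w s = 1 ->
  gsc_lhs (gsc_pos g) (gsc_neg g) (\sum_(s in S) w s *: vec R s) =
  \sum_(s in S) w s * gsc_lhs (gsc_pos g) (gsc_neg g) (vec R s).
Proof.
move=> w1; rewrite gsc_lhsE; under eq_bigr do rewrite lit_conv//.
rewrite exchange_big; apply: eq_bigr => s _.
by rewrite gsc_lhsE mulr_sumr.
Qed.

Lemma conv_hull_vec (S : {set cube_point n}) s : s \in S -> conv_hull S (vec R s).
Proof.
move=> sS; exists (fun t => (t == s)%:R); split=> [t _||].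
- by rewrite ler0n.
- by rewrite (bigD1 s)//= eqxx big1 ?addr0// => t /andP[_ /negPf ->].
- rewrite (bigD1 s)//= eqxx scale1r big1 ?addr0// => t /andP[_ /negPf ->].
  by rewrite scale0r.
Qed.

(** The slacks at points of [S] are nonnegative and their weighted average is zero, so each slack
    carrying nonzero weight vanishes. *)
Lemma gsc_valid_tight (S : {set cube_point n}) (w : cube_point n -> R) g :
  (forall s, s \in S -> 0 <= w s) -> \sum_(s in S) w s = 1 ->
  gsc_valid R S (gsc_pos g) (gsc_neg g) ->
  gsc_lhs (gsc_pos g) (gsc_neg g) (\sum_(s in S) w s *: vec R s) = 1 ->
  forall s, s \in S -> w s != 0 ->
  gsc_lhs (gsc_pos g) (gsc_neg g) (vec R s) = 1.
Proof.
move=> w0 w1 gv; rewrite gsc_lhs_conv// => tight s sS ws.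
have/psumr_eq0P : \sum_(s in S)
    w s * (gsc_lhs (gsc_pos g) (gsc_neg g) (vec R s) - 1) = 0.
  under eq_bigr do rewrite mulrBr mulr1.
  by rewrite sumrB tight w1 subrr.
move=> /(_ _ s sS) H; apply/eqP; rewrite -subr_eq0.
have/eqP : w s * (gsc_lhs (gsc_pos g) (gsc_neg g) (vec R s) - 1) = 0.
  apply: H => t tS; rewrite mulr_ge0 ?w0// subr_ge0; exact/gv/conv_hull_vec.
by rewrite mulf_eq0 (negPf ws).
Qed.

End Literals.

(** * The 2-cover graph, the core, and points aligned with a core point *)

Section CoverGraph.
Context {R : realType} {n : nat} (S : {set cube_point n}).
Implicit Types (g : gsc n) (x y : 'rV[R]_n) (s : cube_point n).

Let e := two_cover_graph R S.

(** With its converse below, this replaces the four sign patterns of an edge by one valid inequality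
    supported on the pair, a form symmetric in [i] and [j]. *)
Lemma two_cover_graph_supp i j : e i j ->
  i != j /\ exists2 g, gsc_valid R S (gsc_pos g) (gsc_neg g) & gsc_supp g = [set i; j]%SET.
Proof.
move=> /andP[ij /asboolP eij]; split=> //.
have d1 a b : a != b -> [disjoint [set a]%SET & [set b : 'I_n]%SET].
  by move=> ab; rewrite disjoints1 inE.
case: eij => v.
- by exists (Gsc (d1 _ _ ij)).
- by rewrite eq_sym in ij; exists (Gsc (d1 _ _ ij)) => //; rewrite /gsc_supp/= finset.setUC.
- have d : [disjoint [set i; j]%SET & (finset.set0 : {set 'I_n})].
    by rewrite -setI_eq0 finset.setI0.
  by exists (Gsc d) => //; rewrite /gsc_supp/= finset.setU0.
- have d : [disjoint (finset.set0 : {set 'I_n}) & [set i; j]%SET].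
    by rewrite -setI_eq0 finset.set0I.
  by exists (Gsc d) => //; rewrite /gsc_supp/= finset.set0U.
Qed.

Lemma supp_two_cover_graph i j g : i != j ->
  gsc_valid R S (gsc_pos g) (gsc_neg g) -> gsc_supp g = [set i; j]%SET -> e i j.
Proof.
move=> ij gv gs; rewrite /e/two_cover_graph ij /=; apply/asboolP.
have Ep k : (k \in gsc_pos g) = (k \in [set i; j]%SET) && (k \in gsc_pos g).
  by rewrite -gs inE; case: (_ \in gsc_pos g); rewrite ?andbF.
have En k := gsc_negE g k.
case ip: (i \in gsc_pos g); case jp: (j \in gsc_pos g).
- apply: Or43; suff [<- <-] : gsc_pos g = [set i; j]%SET /\ gsc_neg g = finset.set0 by [].
  split; apply/setP => k; rewrite 1?Ep ?En ?gs !inE;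
  by do 2?[case: eqVneq => [->|_] /=]; rewrite ?ip ?jp.
- apply: Or41; suff [<- <-] : gsc_pos g = [set i]%SET /\ gsc_neg g = [set j]%SET by [].
  split; apply/setP => k; rewrite 1?Ep ?En ?gs !inE.
    by case: (eqVneq k i) => [->|_] /=; rewrite ?ip//; case: eqVneq => [->|_]//=; rewrite jp.
  case: (eqVneq k i) => [->|_] /=; rewrite ?ip; first by rewrite (negPf ij).
  by case: eqVneq => [->|_]//=; rewrite jp.
- apply: Or42; suff [<- <-] : gsc_pos g = [set j]%SET /\ gsc_neg g = [set i]%SET by [].
  split; apply/setP => k; rewrite 1?Ep ?En ?gs !inE.
    case: (eqVneq k i) => [->|_] /=; rewrite ?ip//; first by rewrite (negPf ij).
    by case: eqVneq => [->|_]//=; rewrite jp.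
  by case: (eqVneq k i) => [->|_] /=; rewrite ?ip//; case: eqVneq => [->|_]//=; rewrite jp.
- apply: Or44; suff [<- <-] : gsc_pos g = finset.set0 /\ gsc_neg g = [set i; j]%SET by [].
  split; apply/setP => k; rewrite 1?Ep ?En ?gs !inE;
  by do 2?[case: eqVneq => [->|_] /=]; rewrite ?ip ?jp.
Qed.

Lemma two_cover_graph_sym : symmetric e.
Proof.
have H i j : e i j -> e j i.
  move=> /two_cover_graph_supp[ij [g gv gs]].
  by apply: (supp_two_cover_graph _ _ _ _ gv); rewrite 1?eq_sym// finset.setUC.
by move=> i j; apply/idP/idP; exact: H.
Qed.

Lemma connect_two_cover_sym : connect_sym e.
Proof. exact/sym_connect_sym/two_cover_graph_sym. Qed.

Lemma coreP s : reflect (s \in S /\ forall g, nvars g = 2%N ->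
    gsc_valid R S (gsc_pos g) (gsc_neg g) ->
    gsc_lhs (gsc_pos g) (gsc_neg g) (vec R s) = 1) (s \in core R S).
Proof. by rewrite inE; apply: (iffP andP) => -[? /asboolP]. Qed.

Lemma gsc_lhs_pair g x i j : i != j -> gsc_supp g = [set i; j]%SET ->
  gsc_lhs (gsc_pos g) (gsc_neg g) x = lit g x i + lit g x j.
Proof. by move=> ij gs; rewrite gsc_lhsE gs big_setU1 ?inE// big_set1. Qed.

(** Two 0/1 literals with sum 1: exactly one of them is true. *)
Lemma core_edge s g i j : i != j -> s \in core R S ->
  gsc_valid R S (gsc_pos g) (gsc_neg g) -> gsc_supp g = [set i; j]%SET ->
  (s j == (j \in gsc_pos g)) = ~~ (s i == (i \in gsc_pos g)).
Proof.
move=> ij /coreP[_ tight] gv gs.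
have := tight g; rewrite (gsc_lhs_pair _ _ _ _ ij)// -card_gsc_supp gs cards2 ij.
move=> /(_ erefl gv); rewrite !lit_vec.
by case: (_ == _); case: (_ == _) => //=; lra.
Qed.

(** Each edge fixes whether its ends agree, independently of the core point; this propagates along a
    path. *)
Lemma core_connect s p i j : s \in core R S -> p \in core R S ->
  connect e i j -> (s i == s j) = (p i == p j).
Proof.
move=> sc pc /connectP[q]; elim: q i => [|k q IH] i /=; first by move=> _ ->; rewrite !eqxx.
move=> /andP[eik ekq] jq; have := IH _ ekq jq.
have [ik [g gv gs]] := two_cover_graph_supp _ _ eik.
have := core_edge s _ _ _ ik sc gv gs; have := core_edge p _ _ _ ik pc gv gs.
by case: (i \in _); case: (k \in _); case: (s i); case: (s k); case: (s j);
   case: (p i); case: (p k); case: (p j).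
Qed.

(** An affine subspace; for [p] in the core it contains all core points and the centre. *)
Definition aligned (p : cube_point n) x :=
  forall i j, connect e i j ->
  x ord0 i = if p i == p j then x ord0 j else 1 - x ord0 j.

Lemma aligned_core s p : s \in core R S -> p \in core R S -> aligned p (vec R s).
Proof.
move=> sc pc i j ij; rewrite !mxE -(core_connect s p i j)//.
by case: (s i); case: (s j); rewrite /= ?subr0 ?subrr.
Qed.

Lemma aligned_segment p x y t : aligned p x -> aligned p y ->
  aligned p ((1 - t) *: x + t *: y).
Proof.
move=> ax ay i j ij; rewrite !mxE (ax i j)// (ay i j)//.
by case: (_ == _) => //; ring.
Qed.

Lemma aligned_half p : aligned p (const_mx 2^-1).
Proof. by move=> i j _; rewrite !mxE; case: (_ == _) => //; field. Qed.

Lemma lit_aligned p x g i j : aligned p x -> connect e i j ->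
  lit g x i = if (p i == p j) == ((i \in gsc_pos g) == (j \in gsc_pos g))
              then lit g x j else 1 - lit g x j.
Proof.
move=> ax ij; rewrite /lit (ax i j ij).
by case: (_ \in _); case: (_ \in _); case: (p i); case: (p j) => //=; ring.
Qed.

(** The two variables are adjacent, so alignment makes the literals equal or complementary at [x];
    tightness at [p] leaves only the complementary case. *)
Lemma aligned_tight p x g : p \in core R S -> aligned p x -> nvars g = 2%N ->
  gsc_valid R S (gsc_pos g) (gsc_neg g) ->
  gsc_lhs (gsc_pos g) (gsc_neg g) x = 1.
Proof.
move=> pc ax; rewrite -card_gsc_supp => /eqP/cards2P[i [j [ij gs]]] gv.
rewrite (gsc_lhs_pair _ _ _ _ ij gs).
have ec := connect1 (supp_two_cover_graph _ _ _ ij gv gs).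
rewrite (lit_aligned p x g i j)//.
have := core_edge p _ _ _ ij pc gv gs.
by case: (i \in _); case: (j \in _); case: (p i); case: (p j) => //= _; ring.
Qed.

Lemma core_of_tight (w : cube_point n -> R) :
  (forall s, s \in S -> 0 <= w s) -> \sum_(s in S) w s = 1 ->
  (forall g, nvars g = 2%N -> gsc_valid R S (gsc_pos g) (gsc_neg g) ->
    gsc_lhs (gsc_pos g) (gsc_neg g) (\sum_(s in S) w s *: vec R s) = 1) ->
  forall s, s \in S -> w s != 0 -> s \in core R S.
Proof.
move=> w0 w1 tight s sS ws; apply/coreP; split => // g g2 gv.
by apply: (gsc_valid_tight S w g w0 w1 gv (tight g g2 gv)).
Qed.

End CoverGraph.

(** * Aligned points in the convex hull *)

Section Description.
Context {R : realType} {n : nat} (S : {set cube_point n}) (D : set (ineq n)).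
Hypothesis (hconn : (2%:E <= connectivity R S)%E) (hD : describes R D S).
Implicit Types (g : gsc n) (x y : 'rV[R]_n) (s p : cube_point n).

Let e := two_cover_graph R S.

Lemma gsc_valid_nvars g : gsc_valid R S (gsc_pos g) (gsc_neg g) -> (2 <= nvars g)%N.
Proof.
move=> gv; rewrite -(ler_nat R) -lee_fin.
by apply: (le_trans hconn); apply: ereal_inf_lbound; exists g.
Qed.

Lemma describesP x : conv_hull S x <-> forall q, D q -> satisfies x q.
Proof. by case: hD => _ ->. Qed.

Lemma described_valid g : D (Cover g) -> gsc_valid R S (gsc_pos g) (gsc_neg g).
Proof. by move=> Dg x /describesP/(_ _ Dg). Qed.

Lemma gsc_lhs_half_ge1 g : gsc_valid R S (gsc_pos g) (gsc_neg g) ->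
  1 <= gsc_lhs (gsc_pos g) (gsc_neg g) (const_mx 2^-1 : 'rV[R]_n).
Proof.
by move=> /gsc_valid_nvars; rewrite -(ler_nat R) gsc_lhs_half; lra.
Qed.

Lemma conv_hull_half : conv_hull S (const_mx 2^-1 : 'rV[R]_n).
Proof.
apply/describesP => -[i|i|g] Dq /=; rewrite ?mxE; [lra|lra|].
exact/gsc_lhs_half_ge1/described_valid.
Qed.

Lemma core_nonempty : exists p, p \in core R S.
Proof.
have [w [w0 w1 hw]] := conv_hull_half.
have [s sS ws] : exists2 s, s \in S & w s != 0.
  apply/exists_inP; apply: contra_eqT w1 => /exists_inPn H.
  by rewrite big1 1?eq_sym ?oner_eq0// => s /H/negPn/eqP.
exists s; apply: (core_of_tight S w w0 w1 _ s sS ws) => g g2 gv; 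
by rewrite -hw gsc_lhs_half g2 mulVf.
Qed.

(* On a violated cover inequality that meets a component twice, the two literals
   are either complementary, so the inequality holds, or equal, in which case
   every core point on which it is tight makes both vanish. *)
Lemma aligned_conv_hull p x : p \in core R S -> aligned S p x ->
  (forall i, 0 <= x ord0 i <= 1) ->
  (forall g, D (Cover g) -> rainbow R S g ->
    1 <= gsc_lhs (gsc_pos g) (gsc_neg g) x) ->
  conv_hull S x.
Proof.
move=> pc ax x01 xrb; apply/describesP => q Dq; apply: contrapT => xq.
have {q Dq xq} [g0 Dg0 xg0] : exists2 g, D (Cover g)
    & gsc_lhs (gsc_pos g) (gsc_neg g) x < 1.
  case: q Dq xq => [i|i|g] Dq /=; have := x01; last first.
    by move=> _ /negP; rewrite -ltNge; exists g.
  - by move=> /(_ i)/andP[_ ->].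
  - by move=> /(_ i)/andP[->].
pose h : 'rV[R]_n := const_mx 2^-1.
(* Pairs of sets provide the finite index type for [first_zero_affine]. *)
pose P (IJ : {set 'I_n} * {set 'I_n}) :=
  `[< exists2 g, D (Cover g) & (gsc_pos g, gsc_neg g) = IJ >].
pose slack y (IJ : {set 'I_n} * {set 'I_n}) := gsc_lhs IJ.1 IJ.2 y - 1.
have [||IJ] := first_zero_affine P (slack h) (slack x).
- move=> _ /asboolP[g Dg <-]; rewrite /slack/= subr_ge0.
  exact/gsc_lhs_half_ge1/described_valid.
- exists (gsc_pos g0, gsc_neg g0); first by apply/asboolP; exists g0.
  by rewrite /slack/= subr_lt0.
move=> [t [/asboolP[g Dg <-]]]; rewrite /slack/= subr_lt0.
move=> xg /andP[t0 t1] zg zD.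
(* On the way from the centre to [x], all cover inequalities of [D] still hold at [z], while [g],
   violated at [x], is tight there. *)
pose z : 'rV[R]_n := (1 - t) *: h + t *: x.
have az : aligned S p z by apply: aligned_segment => //; exact: aligned_half.
have zC : conv_hull S z.
  apply/describesP => -[i|i|g'] Dq /=.
  - by have := x01 i; rewrite !mxE; nra.
  - by have := x01 i; rewrite !mxE; nra.
  - have := zD (gsc_pos g', gsc_neg g').
    rewrite /z gsc_lhs_segment /= => H.
    have : P (gsc_pos g', gsc_neg g') by apply/asboolP; exists g'.
    by move=> /H; lra.
have zg1 : gsc_lhs (gsc_pos g) (gsc_neg g) z = 1.
  by rewrite /z gsc_lhs_segment; lra.
have gv := described_valid g Dg.
have /asboolPn : ~ rainbow R S g by move=> /(xrb g Dg); rewrite leNgt xg.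
move=> /asboolPn nrb.
have [i [j [ij ig jg cij]]] : exists i j, [/\ i != j, i \in gsc_supp g,
    j \in gsc_supp g & connect e i j].
  apply: contrapT => H; apply: nrb; split => // k; rewrite leqNgt.
  apply/negP => /card_gt1P[i [j [+ + ij]]]; rewrite !inE => /andP[ig ki] /andP[jg kj].
  apply: H; exists i, j; rewrite /gsc_supp !inE ig jg ij; split => //.
  apply: connect_trans kj; by rewrite connect_two_cover_sym.
have lit2 y : (forall k, 0 <= y ord0 k <= 1) ->
    lit g y i + lit g y j <= gsc_lhs (gsc_pos g) (gsc_neg g) y.
  move=> y01; rewrite gsc_lhsE (bigD1 i)//= lerD2l (bigD1 j)/=; last first.
    by rewrite jg eq_sym.
  by rewrite lerDl sumr_ge0// => k _; exact: lit_ge0.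
(* Whether alignment with [p] makes the two literals equal (true) or complementary (false). *)
pose sg := (p i == p j) == ((i \in gsc_pos g) == (j \in gsc_pos g)).
have sgP y : aligned S p y -> lit g y i = if sg then lit g y j else 1 - lit g y j.
  by move=> ay; exact: (lit_aligned S p).
have := lit2 x x01; rewrite (sgP x ax).
case: sg sgP => sgP xij; last by move: xij xg; lra.
have [w [w0 w1 zw]] := zC.
have z_lit : lit g z i = 0.
  rewrite zw lit_conv// big1// => s sS.
  have [->|ws] := eqVneq (w s) 0; first by rewrite mul0r.
  (* [z] is aligned, hence tight for every valid 2-GSC inequality, so it averages core points
     only. *)
  have sc : s \in core R S.
    apply: (core_of_tight S w w0 w1 _ s sS ws) => g' g2 g'v; rewrite -zw.
    exact: (aligned_tight S p).
  have sg1 : gsc_lhs (gsc_pos g) (gsc_neg g) (vec R s) = 1.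
    by apply: (gsc_valid_tight S w g w0 w1 gv _ s sS ws); rewrite -zw.
  have := lit2 (vec R s); rewrite sg1 -(sgP _ (aligned_core S s p sc pc)).
  rewrite lit_vec; case: (_ == _); last by rewrite mulr0.
  rewrite gerDl ler10 => H; have : false; last by [].
  by apply: H => k; rewrite mxE; case: (s k); rewrite /= ?lexx ?ler01.
(* The literal equals 1/2 at the centre and is nonnegative at [x]; since [t < 1] it is positive at
   [z], a contradiction. *)
have := z_lit; rewrite lit_segment => zi0.
have := lit_ge0 g x i (x01 i).
by rewrite lit_half in zi0; move=> xi; nra.
Qed.

End Description.

(** * Entropy bound for product weights *)

(** The logarithm of the weight is affine in [k], nonincreasing because [ep <= 1 - ep], and equals
    that of the left side at [k = ep * d]. *)
Lemma entropy_bernoulli_weight {R : realType} (ep : R) (k d : nat) :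
  0 <= ep <= 2^-1 -> (k <= d)%N -> k%:R <= ep * d%:R ->
  2 `^ (- entropy ep * d%:R) <= ep ^+ k * (1 - ep) ^+ (d - k).
Proof.
move=> /andP[ep0 ep2] kd kep; have [epE|epN0] := eqVneq ep 0.
  (* For [ep = 0] both sides are 1, by the conventions H(0) = 0 and [0 ^+ 0 = 1]. *)
  have -> : k = 0%N.
    by apply/eqP; move: kep; rewrite epE mul0r lern0.
  by rewrite /entropy epE eqxx oppr0 mul0r powRr0 addr0 expr1n mulr1.
have {epN0}ep0 : 0 < ep by rewrite lt_neqAle eq_sym epN0.
have ep1 : 0 < 1 - ep by lra.
have ln2 : 0 < ln 2 :> R by rewrite ln_gt0// ltr1n.
have lnle : ln ep <= ln (1 - ep) by rewrite ler_ln ?posrE//; lra.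
rewrite -ler_ln ?posrE ?powR_gt0// ?mulr_gt0 ?exprn_gt0//.
rewrite ln_powR lnM ?posrE ?exprn_gt0// !lnXn// /entropy (gt_eqF ep0) /log2.
have -> : - (- ep * (ln ep / ln 2) - (1 - ep) * (ln (1 - ep) / ln 2)) * d%:R * ln 2
   = (ep * ln ep + (1 - ep) * ln (1 - ep)) * d%:R.
  by field; rewrite gt_eqF.
rewrite -[ln ep *+ _]mulr_natr -[ln (1 - ep) *+ _]mulr_natr natrB// -subr_ge0.
have -> : ln ep * k%:R + ln (1 - ep) * (d%:R - k%:R) -
    (ep * ln ep + (1 - ep) * ln (1 - ep)) * d%:R =
    (ep * d%:R - k%:R) * (ln (1 - ep) - ln ep) by ring.
by rewrite mulr_ge0// subr_ge0.
Qed.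

Lemma prod_bernoulli {R : realType} {C : finType} (ep : R) (a : pred C) :
  \prod_c (if a c then 1 - ep else ep) =
  ep ^+ #|[pred c | ~~ a c]| * (1 - ep) ^+ (#|C| - #|[pred c | ~~ a c]|).
Proof.
rewrite (bigID a)/= (eq_bigr (fun=> 1 - ep)); last by move=> c ->.
rewrite [X in _ * X](eq_bigr (fun=> ep)); last by move=> c /negPf ->.
rewrite !prodr_const mulrC; congr (_ * _ ^+ _).
by rewrite -(cardC [pred c | ~~ a c]) addKn; apply: eq_card => c; rewrite !inE negbK.
Qed.

(** * Components and the count of core points *)

Section Counting.
Context {R : realType} {n : nat} (S : {set cube_point n}).

Let e := two_cover_graph R S.

(** Components are encoded by canonical roots, so a choice of one bit per component is a finite
    function. *)
Definition component := {i : 'I_n | roots e i}.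

Definition component_of i : component :=
  exist _ (fingraph.root e i) (roots_root (connect_two_cover_sym S) i).

Lemma card_component : #|{: component}| = ncomponents R S.
Proof. by rewrite card_sig; apply: eq_card => i; rewrite !inE andbT. Qed.

Lemma component_of_val (c : component) : component_of (val c) = c.
Proof. by apply/val_inj/eqP; exact: (valP c). Qed.

Lemma component_of_connect i j : connect e i j -> component_of i = component_of j.
Proof.
by move=> ij; apply/val_inj/eqP; rewrite /= root_connect//; exact: connect_two_cover_sym.
Qed.

(** The bit of [v] sets the value at the root; another coordinate is complemented exactly when [p]
    differs there from its value at the root. *)
Definition component_point (p : cube_point n) (ep : R) (v : {ffun component -> bool}) :
    'rV[R]_n :=
  \row_i if v (component_of i) (+) p (val (component_of i)) (+) p i
         then 1 - ep else ep.

Lemma aligned_component_point p ep v : aligned S p (component_point p ep v).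
Proof.
move=> i j ij; rewrite !mxE (component_of_connect i j ij).
case: (v _); case: (p (val _)); case: (p i); case: (p j) => /=; ring.
Qed.

Lemma component_point_val p ep v (c : component) :
  component_point p ep v ord0 (val c) = if v c then 1 - ep else ep.
Proof. by rewrite mxE component_of_val -addbA addbb addbF. Qed.

Lemma component_point_bounds p ep v i : 0 <= ep <= 2^-1 ->
  ep <= component_point p ep v ord0 i <= 1 - ep.
Proof. by move=> ?; rewrite mxE; case: ifP => _; lra. Qed.

Lemma core_near p ep (v : {ffun component -> bool}) : p \in core R S ->
  conv_hull S (component_point p ep v) ->
  exists2 s, s \in core R S &
    #|[pred c : component | s (val c) != v c]|%:R <= ep * (ncomponents R S)%:R.
Proof.
move=> pc [w [w0 w1 xw]].
pose dist (s : cube_point n) : R := #|[pred c : component | s (val c) != v c]|%:R.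
(* Linearity of expectation: under [w], each root coordinate differs from [v] with probability
   [ep]. *)
have avg : \sum_(s in S) w s * (ep * (ncomponents R S)%:R - dist s) = 0.
  under eq_bigr do rewrite mulrBr.
  rewrite sumrB -mulr_suml w1 mul1r; apply/eqP; rewrite subr_eq0; apply/eqP.
  have distE s : dist s = \sum_(c : component) (s (val c) != v c)%:R.
    by rewrite /dist -sum1_card natr_sum big_mkcond; apply: eq_bigr => c _; rewrite inE; case: (_ == _).
  under [RHS]eq_bigr do rewrite distE mulr_sumr.
  rewrite exchange_big /= -card_component mulr_natr -sumr_const; apply: eq_bigr => c _.
  have : \sum_(s in S) w s * (s (val c))%:R = if v c then 1 - ep else ep.
    rewrite -(component_point_val p ep v) xw summxE.
    by apply: eq_bigr => s _; rewrite !mxE.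
  case: (v c) => [xc|<-].
    rewrite -[LHS](subKr 1) -xc -[X in X - _]w1 -sumrB; apply: eq_bigr => s _.
    by case: (s _); rewrite /=; ring.
  by apply: eq_bigr => s _; case: (s _).
(* If all core points were farther than the mean, a zero sum of nonnegative terms would force [w] to
   vanish on [S], against its total of 1. *)
apply: contrapT => far.
have xt : forall g : gsc n, nvars g = 2%N -> gsc_valid R S (gsc_pos g) (gsc_neg g) ->
    gsc_lhs (gsc_pos g) (gsc_neg g) (\sum_(s in S) w s *: vec R s) = 1.
  move=> g g2 gv; rewrite -xw; apply: (aligned_tight S p) => //.
  exact: aligned_component_point.
have farS s : s \in S -> w s != 0 -> 0 < dist s - ep * (ncomponents R S)%:R.
  move=> sS ws; rewrite subr_gt0 ltNge; apply/negP => ds; apply: far.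
  by exists s => //; exact: (core_of_tight S w w0 w1 xt).
have/psumr_eq0P : \sum_(s in S) w s * (dist s - ep * (ncomponents R S)%:R) = 0.
  apply/eqP; rewrite -oppr_eq0 -sumrN -[X in _ == X]avg; apply/eqP.
  by apply: eq_bigr => s _; ring.
move=> H; move: w1; rewrite big1; first by move=> /eqP; rewrite eq_sym oner_eq0.
move=> s sS; apply/eqP/negPn/negP => ws.
have/eqP : w s * (dist s - ep * (ncomponents R S)%:R) = 0.
  apply: H => // t tS; have [->|wt] := eqVneq (w t) 0; first by rewrite mul0r.
  by rewrite mulr_ge0 ?w0// ltW// farS.
by rewrite mulf_eq0 (negPf ws)/= gt_eqF// farS.
Qed.

Lemma core_card_ge p ep : 0 <= ep <= 2^-1 -> p \in core R S ->
  (forall v, conv_hull S (component_point p ep v)) ->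
  2 `^ ((1 - entropy ep) * (ncomponents R S)%:R) <= #|core R S|%:R.
Proof.
move=> ep2 pc vC; pose d := ncomponents R S.
(* The probability of obtaining [v] when the root bits of [s] are flipped independently with
   probability [ep]. *)
pose wt (s : cube_point n) (v : {ffun component -> bool}) : R :=
  \prod_c (if s (val c) == v c then 1 - ep else ep).
have wt0 s v : 0 <= wt s v by apply: prodr_ge0 => c _; case: ifP => _; lra.
have wt1 s : \sum_v wt s v = 1.
  rewrite -(bigA_distr_bigA (fun c b => if s (val c) == b then 1 - ep else ep)).
  by apply: big1 => c _; rewrite big_bool; case: (s _) => /=; ring.
have near v : 2 `^ (- entropy ep * d%:R) <= \sum_(s in core R S) wt s v.
  have [s sc ds] := core_near p ep v pc (vC v).
  (* The term of the nearby core point alone already reaches the bound. *)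
  rewrite (bigD1 s)//= -[leLHS]addr0 lerD ?sumr_ge0//.
  rewrite /wt prod_bernoulli card_component entropy_bernoulli_weight//.
  by rewrite /d -card_component max_card.
have -> : 2 `^ ((1 - entropy ep) * d%:R) =
    \sum_(v : {ffun component -> bool}) 2 `^ (- entropy ep * d%:R) :> R.
  rewrite sumr_const card_ffun card_bool card_component -/d.
  rewrite mulrDl mul1r powRD ?pnatr_eq0 ?implybT// powR_mulrn ?ler0n//.
  by rewrite -natrX mulr_natl.
apply: (le_trans (ler_sum _ (fun v _ => near v))).
rewrite exchange_big (eq_bigr _ (fun s _ => wt1 s)).
by rewrite sumr_const.
Qed.

End Counting.

Theorem theorem1p4 (R : realType) (n : nat) (S : {set cube_point n})
    (D : set (ineq n))
    (hideal : cube_ideal R S)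
    (hconn : (2%:E <= connectivity R S)%E)
    (hD : describes R D S) :
  2 `^ ((1 - entropy (recip (kappa R S D))) * (ncomponents R S)%:R)
    <= (#|core R S|)%:R :> R.
Proof.
have [p pc] := core_nonempty S D hconn hD.
have k2 : (2%:E <= kappa R S D)%E.
  apply: le_ereal_inf_tmp => _ [g [_ [gv _]] <-].
  by rewrite lee_fin ler_nat (gsc_valid_nvars S hconn).
have kle g : D (Cover g) -> rainbow R S g -> (kappa R S D <= (nvars g)%:R%:E)%E.
  by move=> Dg gr; apply: ereal_inf_lbound; exists g.
have [ep2 epM] : 0 <= recip (kappa R S D) <= 2^-1 /\
    forall g, D (Cover g) -> rainbow R S g ->
    1 <= recip (kappa R S D) * (nvars g)%:R.
  (* If [kappa] is infinite, [recip] gives 0 and [D] has no rainbow inequality, so the second claim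
     is vacuous. *)
  case: (kappa R S D) k2 kle => [k| |] //=; last first.
    by move=> _ kle; split=> [|g Dg /(kle g Dg)//]; lra.
  rewrite lee_fin => k2 kle; have k0 : 0 < k by lra.
  rewrite invr_ge0 (ltW k0) lef_pV2 ?posrE//; split=> // g Dg /(kle g Dg).
  by rewrite lee_fin mulrC ler_pdivlMr// mul1r.
apply: (core_card_ge S p) => // v.
have xb i := component_point_bounds S p _ v i ep2.
apply: (aligned_conv_hull S D hconn hD p) => //.
- exact: aligned_component_point.
- by move=> i; have := xb i; lra.
(* Every literal is at least [ep] at this point, and [ep] times the number of variables is at least
   1. *)
move=> g Dg /(epM g Dg) /le_trans; apply.
rewrite gsc_lhsE -card_gsc_supp mulr_natr -sumr_const; apply: ler_sum => i _.
by rewrite /lit; have := xb i; case: ifP => _; lra.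
Qed.
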